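(* Assume that the training and aggregation samples are independent. Conditionally on the training sample (so that the candidate estimators $\tilde\theta_{n,k}$ are treated as fixed), assume that there exist positive absolute constants $\xi_1,\xi_2,\xi_3$ such that, for every sufficiently large $n$ and every $\theta\in\Theta_n$, $$P_\star^{(n)}\left[\exp(-\lambda\{\ell_n(\theta)-\ell_n^\star\})\right]\le \exp(-\xi_1\mathcal L_n(\theta)),\qquad P_\star^{(n)}\left[\exp(\lambda\xi_2\{\ell_n(\theta)-\ell_n^\star\})\right]\le \exp(\xi_3\mathcal L_n(\theta)).$$ Then there exist absolute constants $\tilde\tau_*>0$ and $C_8>0$ such that, conditionally on the training sample, for every sufficiently large $n$, $$P_\star^{(n)}\left(\tilde m_n\ge\tilde k_n^\dagger(\tilde\tau_* )+1\right)\ge1-\tilde\eta_n,\qquad\tilde\eta_n:=\tilde k_n^\dagger(\tilde\tau_* )\exp\left(-C_8\,\mathcal L_n\left(\tilde\theta_{n,\tilde k_n^\dagger(\tilde\tau_* )}\right)\right).$$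
   Context: Setup. The full sample is split into a training sample and an aggregation sample. $X^{(n)}$, with values in a measurable space $\mathcal X_n$, denotes the aggregation sample and $P_\star^{(n)}$ its true distribution; $P_\star^{(n)}[\cdot]$ denotes expectation and $P_\star^{(n)}(\cdot)$ probability with respect to the aggregation sample. $\mathcal P(\cdot)$ is the set of probability measures on a space; $[m]=\{1,\dots,m\}$; $a\wedge b=\min\{a,b\}$. The models are parameter spaces $\Theta_{n,1},\dots,\Theta_{n,M_n}$, each $\theta$ indexing a distribution $P_\theta^{(n)}\in\mathcal P(\mathcal X_n)$, and they are nested: for each $k<M_n$ there is an embedding $T:\Theta_{n,k}\to\Theta_{n,k+1}$ with $P^{(n)}_\theta=P^{(n)}_{T(\theta)}$ for all $\theta\in\Theta_{n,k}$. Put $\Theta_n=\bigcup_{k=1}^{M_n}\Theta_{n,k}$. A loss $\ell_n:\mathcal P(\mathcal X_n)\times\mathcal X_n\to[0,\infty)$ is given; write $\ell_n(\theta)=\ell_n(P_\theta^{(n)},X^{(n)})$ and $\ell_n^\star=\ell_n(P_\star^{(n)},X^{(n)})$ (losses evaluated on the aggregation sample). The excess risk is $\mathcal L_n(\theta)=P_\star^{(n)}[\ell_n(\theta)-\ell_n^\star]$. $\lambda>0$ is a fixed constant. ''Absolute constant'' means a constant not depending on $n$ or $k$. For each $k\in[M_n]$, $\tilde\theta_{n,k}\in\Theta_{n,k}$ is a candidate estimator (not necessarily an empirical risk minimizer) computed from the training sample only. Stopping index: $\tilde m_n=\inf\{k\in[M_n]\setminus\{1\}:\ell_n(\tilde\theta_{n,k-1})<\ell_n(\tilde\theta_{n,k})\}\wedge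 M_n$ (with $\inf\emptyset=\infty$). Near-optimal index: for $\tau>0$, $\tilde k_n^\dagger(\tau)=\inf\{k\in[M_n]:\mathcal L_n(\tilde\theta_{n,k})\le(1+\tau)\mathcal L_n(\tilde\theta_{n,k+1})\}\wedge M_n$ (so it equals $M_n$ if no $k<M_n$ satisfies the inequality).
   Formalization: The event is stated as m̃ ≥ min(k†+1, M_n) instead of m̃ ≥ k†+1: when k† = M_n the original event is empty (m̃ ≤ M_n) and the claim fails, e.g. M_n = 1 with excess loss identically 1; for k† < M_n the event is unchanged. *)

(* Defs.v *)
From HB Require Import structures.
From mathcomp Require Import all_boot all_order all_algebra.
From mathcomp Require Import all_classical all_reals all_analysis.

Set Implicit Arguments.
Unset Strict Implicit.
Unset Printing Implicit Defensive.

Import Order.TTheory GRing.Theory Num.Theory.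
Import numFieldNormedType.Exports.

Local Open Scope classical_set_scope.
Local Open Scope ring_scope.

(* A [probability] carries a value for every set, but only its values on the
   measurable sets are meaningful; equality of laws is therefore stated on
   those. *)
Definition same_law d (T : measurableType d) (R : realType)
    (P Q : probability T R) : Prop :=
  forall A : set T, measurable A -> P A = Q A.

Definition has_law d d' (Omega : measurableType d) (T : measurableType d')
    (R : realType) (Pr : probability Omega R) (X : {mfun Omega >-> T})
    (P : probability T R) : Prop :=
  forall A : set T, measurable A -> distribution Pr X A = P A.

Definition independent_rv d d1 d2 (Omega : measurableType d)
    (T1 : measurableType d1) (T2 : measurableType d2) (R : realType)
    (Pr : probability Omega R)
    (X : {mfun Omega >-> T1}) (Y : {mfun Omega >-> T2}) : Prop :=
  forall (A : set T1) (B : set T2), measurable A -> measurable B ->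
    Pr ((X @^-1` A) `&` (Y @^-1` B)) = (Pr (X @^-1` A) * Pr (Y @^-1` B))%E.

(* The models are subsets [Theta k] of one carrier [U], so that their union is
   a set of the same type and [law] does not depend on the model index.  Models
   living in unrelated types are covered by taking their disjoint sum for [U]. *)
Definition full_model (U : Type) (Theta : nat -> set U) (M : nat) : set U :=
  \bigcup_(k in [set k : nat | (1 <= k <= M)%N]) Theta k.

Definition nested d (T : measurableType d) (R : realType) (U : Type)
    (law : U -> probability T R) (Theta : nat -> set U) (M : nat) : Prop :=
  forall k : nat, (1 <= k < M)%N ->
    exists iota : U -> U,
      [/\ forall theta, Theta k theta -> Theta k.+1 (iota theta),
          set_inj (Theta k) iota &
          forall theta, Theta k theta -> same_law (law theta) (law (iota theta))].

Section ExcessRisk.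
Context d (T : measurableType d) (R : realType) (U : Type).
Variables (law : U -> probability T R) (Pstar : probability T R).
Variable ell : probability T R -> T -> R.

Definition excess_loss (theta : U) (x : T) : R :=
  ell (law theta) x - ell Pstar x.

(* [fine] sends an infinite (or undefined) expectation to 0.  Under
   [exp_moment_bounds] this never happens: both exponential moments of the
   excess loss are then bounded by a real number, so it is integrable. *)
Definition excess_risk (theta : U) : R := fine 'E_Pstar[excess_loss theta].

(* The expectations are extended-real: an infinite exponential moment violates
   the bound. *)
Definition exp_moment_bounds (lambda xi1 xi2 xi3 : R) (theta : U) : Prop :=
  ('E_Pstar[fun x => expR (- lambda * excess_loss theta x)]
     <= (expR (- xi1 * excess_risk theta))%:E)%E
  /\
  ('E_Pstar[fun x => expR (lambda * xi2 * excess_loss theta x)]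
     <= (expR (xi3 * excess_risk theta))%:E)%E.

End ExcessRisk.

(* In both indices an iterated minimum with neutral value [M] renders
   [inf S /\ M], the empty infimum being infinite.  The argument [l k] is the
   loss, resp. [L k] the risk, of the k-th candidate, 1 <= k <= M. *)
Definition stopping_index (R : realType) (M : nat) (l : nat -> R) : nat :=
  \big[minn/M]_(2 <= k < M.+1 | l k.-1 < l k) k.

(* [k = M] is left out of the range: there is no candidate [M + 1], and [M] is
   the default value anyway. *)
Definition near_optimal_index (R : realType) (M : nat) (L : nat -> R)
    (tau : R) : nat :=
  \big[minn/M]_(1 <= k < M | L k <= (1 + tau) * L k.+1) k.

(* Main.v *)
(* If m~ < (k^dagger + 1) /\ M then l(theta_(k-1)) < l(theta_k) for some
   2 <= k <= k^dagger.  Such a crossing has risk drop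
   L(theta_(k-1)) > (1 + tau) L(theta_k), and weighted AM-GM applied to the two
   exponential moments bounds its probability by
   exp (- xi2 (xi1 L(theta_(k-1)) - (xi3 / xi2) L(theta_k)) / (1 + xi2)), which
   for tau = xi3 / (xi1 xi2) is at most exp (- C8 L(theta_k)) with
   C8 = xi1 xi2 / (1 + xi2); a union bound over k concludes.  The excess risk
   may be negative, but L(theta_(k^dagger)) <= 0 makes eta >= 1 and the bound
   vacuous, and otherwise the drops make all risks up to k^dagger at least
   L(theta_(k^dagger)) > 0. *)
Require Import Defs.
From HB Require Import structures.
From mathcomp Require Import all_boot all_order all_algebra.
From mathcomp Require Import all_classical all_reals all_analysis.
From mathcomp Require Import measurable_realfun zify ring lra.

Set Implicit Arguments.
Unset Strict Implicit.
Unset Printing Implicit Defensive.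

Import Order.TTheory GRing.Theory Num.Theory.
Import numFieldNormedType.Exports.

Local Open Scope classical_set_scope.
Local Open Scope ring_scope.

Lemma measurable_set_ltr d (T : measurableType d) (R : realType) (f g : T -> R) :
  measurable_fun [set: T] f -> measurable_fun [set: T] g ->
  measurable [set x | f x < g x].
Proof.
move=> mf mg; rewrite -[X in measurable X]setTI.
exact: (measurable_fun_ltr mf mg measurableT (Y := [set true])).
Qed.

(** Both indices are iterated minima with default [M], so this one characterization yields the
    minimality of the near-optimal index and the description of the stopping event. *)
Lemma leq_bigminnP (M a b : nat) (S : pred nat) (K : nat) :
  reflect ((K <= M)%N /\ forall k, (a <= k < b)%N -> S k -> (K <= k)%N)
          (K <= \big[minn/M]_(a <= k < b | S k) k)%N.
Proof.
apply: (iffP idP).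
- move=> h; split=> [|k kab Sk]; apply: (leq_trans h).
    by elim/big_rec: _ => // k y _; apply: leq_trans; exact: geq_minr.
  move: kab; rewrite -mem_index_iota; elim: (index_iota a b) => // j r IHr.
  rewrite inE big_cons => /predU1P[<-|/IHr kr]; first by rewrite Sk geq_minl.
  by case: ifP => // _; rewrite geq_min kr orbT.
- case=> KM h; rewrite big_seq_cond; elim/big_ind: _ => //.
    by move=> x y Kx Ky; rewrite leq_min Kx Ky.
  by move=> k /andP[]; rewrite mem_index_iota => /h.
Qed.

(* The weights make [x] and [y] enter the tangent bound [1 + t <= expR t] only
   through [y - x], and [s] cancels [p] and [q]. *)
Lemma expR_crossing_ge1 (R : realType) (a b p q s x y : R) :
    0 < a -> 0 < b -> s = (b * p + a * q) / (a + b) -> x < y ->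
  1 <= b / (a + b) * (expR (s - p) * expR (- a * x))
     + a / (a + b) * (expR (s - q) * expR (b * y)).
Proof.
move=> a0 b0 sE xy; rewrite -!expRD.
have ab0 : 0 < a + b by rewrite addr_gt0.
have wb : 0 < b / (a + b) by rewrite divr_gt0.
have wa : 0 < a / (a + b) by rewrite divr_gt0.
apply: le_trans (lerD (ler_wpM2l (ltW wb) (expR_ge1Dx _))
                      (ler_wpM2l (ltW wa) (expR_ge1Dx _))).
have -> : b / (a + b) * (1 + (s - p + - a * x))
        + a / (a + b) * (1 + (s - q + b * y))
        = 1 + a * b / (a + b) * (y - x).
  by rewrite sE; field; rewrite gt_eqF.
by rewrite lerDl mulr_ge0 ?subr_ge0 ?ltW// divr_gt0 ?mulr_gt0.
Qed.

(** A Markov-type argument: by [expR_crossing_ge1] a positive combination of the two exponentials is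
    at least 1 on the event [f < g], so its integral bounds the probability. No joint moment of [f]
    and [g] enters. *)
Lemma crossing_probability_le d (T : measurableType d) (R : realType)
    (P : probability T R) (f g : T -> R) (a b p q : R) :
    measurable_fun [set: T] f -> measurable_fun [set: T] g ->
    0 < a -> 0 < b ->
    ('E_P[fun x => expR (- a * f x)] <= (expR p)%:E)%E ->
    ('E_P[fun x => expR (b * g x)] <= (expR q)%:E)%E ->
  (P [set x | (f x < g x)%R] <= (expR ((b * p + a * q) / (a + b)))%:E)%E.
Proof.
move=> mf mg a0 b0; rewrite unlock => Ef Eg.
set s := (b * p + a * q) / (a + b).
have ab0 : 0 < a + b by rewrite addr_gt0.
(* The factors [expR (s - p)] and [expR (s - q)] turn both moment bounds into the same [expR s]; the
   weights then sum to 1. *)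
pose cf := b / (a + b) * expR (s - p); pose cg := a / (a + b) * expR (s - q).
have cf0 : 0 <= cf by rewrite mulr_ge0 ?expR_ge0// divr_ge0 ?ltW.
have cg0 : 0 <= cg by rewrite mulr_ge0 ?expR_ge0// divr_ge0 ?ltW.
pose F x := expR (- a * f x); pose G x := expR (b * g x).
have F0 x : 0 <= F x by exact: expR_ge0.
have G0 x : 0 <= G x by exact: expR_ge0.
have mF : measurable_fun [set: T] F.
  by apply: measurableT_comp => //; apply: measurable_funM.
have mG : measurable_fun [set: T] G.
  by apply: measurableT_comp => //; apply: measurable_funM.
have mH : measurable_fun [set: T] (fun x => (cf * F x + cg * G x)%:E).
  apply/measurable_EFinP.
  by apply: measurable_funD; apply: measurable_funM.
have H0 x : (0 <= (cf * F x + cg * G x)%:E)%E.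
  by rewrite lee_fin addr_ge0// mulr_ge0.
have mB : measurable [set x | f x < g x] by exact: measurable_set_ltr.
rewrite -[X in (X <= _)%E]mul1e -(integral_cst P mB 1%:E).
apply: (@le_trans _ _ (\int[P]_x (cf * F x + cg * G x)%:E)%E).
  apply: (@le_trans _ _
    (\int[P]_(x in [set x | (f x < g x)%R]) (cf * F x + cg * G x)%:E)%E).
    apply: ge0_le_integral => //.
    - exact: measurable_funTS.
    - move=> x /= fg; rewrite lee_fin /cf /cg.
      rewrite -(mulrA _ _ (F x)) -(mulrA _ _ (G x)).
      exact: expR_crossing_ge1.
  exact: ge0_subset_integral.
under eq_integral do rewrite EFinD !EFinM.
rewrite ge0_integralD//=; first last.
- by apply: measurable_funeM; apply/measurable_EFinP.
- by move=> x _; rewrite mule_ge0// lee_fin.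
- by apply: measurable_funeM; apply/measurable_EFinP.
- by move=> x _; rewrite mule_ge0// lee_fin.
rewrite !ge0_integralZl ?lee_fin//; first last.
- by move=> x _; rewrite lee_fin.
- exact/measurable_EFinP.
- by move=> x _; rewrite lee_fin.
- exact/measurable_EFinP.
apply: (le_trans (leeD (lee_wpmul2l _ Ef) (lee_wpmul2l _ Eg)));
  rewrite ?lee_fin// /cf /cg.
rewrite -(mulrA _ _ (expR p)) -(mulrA _ _ (expR q)) -!expRD !subrK.
by rewrite -!mulrDl (addrC b) divff ?mul1r// gt_eqF.
Qed.

Lemma near_optimal_indexP (R : realType) (M : nat) (L : nat -> R) (tau : R) :
  let kdag := near_optimal_index M L tau in
  (kdag <= M)%N /\
  forall k, (1 <= k < kdag)%N -> (1 + tau) * L k.+1 < L k.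
Proof.
move=> kdag; have [kM kmin] := leq_bigminnP _ _ _ _ _ (leqnn kdag).
split=> // k /andP[k1 kk]; rewrite ltNge; apply/negP => Lk.
by have := kmin k; rewrite k1 (leq_trans kk kM) Lk leqNgt kk => /(_ isT isT).
Qed.

Lemma near_optimal_index_gt0 (R : realType) (M : nat) (L : nat -> R) (tau : R) :
  (0 < M)%N -> (0 < near_optimal_index M L tau)%N.
Proof. by move=> M0; apply/leq_bigminnP; split=> // k /andP[]. Qed.

(** Descending induction from [kdag]: a nonnegative risk only grows when multiplied by [1 + tau], so
    each strict drop makes the preceding risk at least as large. *)
Lemma risk_ge_near_optimal (R : realType) (M : nat) (L : nat -> R) (tau : R) :
  let kdag := near_optimal_index M L tau in
  0 < tau -> 0 <= L kdag ->
  forall k, (1 <= k <= kdag)%N -> L kdag <= L k.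
Proof.
move=> kdag tau0 Lkdag k /andP[k1 kk].
have [_ drop] := near_optimal_indexP M L tau; rewrite -/kdag in drop.
(* The index is written as [kdag - j] for an induction on [j]; the bound [j < kdag] keeps it at
   least 1. *)
rewrite -(subKn kk); have := leq_subr k kdag.
have : (kdag - k < kdag)%N by rewrite ltn_subrL k1 (leq_trans k1 kk).
elim: (kdag - k)%N => [|j IHj] jk _; first by rewrite subn0.
have L1 := IHj (ltnW jk) (ltnW (ltnW jk)).
apply: (le_trans L1); have := drop (kdag - j.+1)%N.
rewrite subn_gt0 jk ltn_subrL ltn0Sn (leq_trans _ jk)//= => /(_ isT).
rewrite subnSK ?(ltnW jk)// => /ltW; apply: le_trans.
by rewrite ler_peMl ?(le_trans Lkdag)// lerDl ltW.
Qed.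

(** The index of the union is shifted by 2, as crossings start at the second candidate. [K <= M]
    takes care of the default value and keeps all crossings below [K] in the range. *)
Lemma stopping_index_ge_setE (T : Type) (R : realType) (M K : nat)
    (l : nat -> T -> R) : (K <= M)%N ->
  [set x | (K <= stopping_index M (fun k => l k x))%N] =
  ~` \big[setU/set0]_(k < K - 2) [set x | l k.+1 x < l k.+2 x].
Proof.
move=> KM; rewrite -(bigcup_mkord _ (fun k => [set x | l k.+1 x < l k.+2 x])).
apply/seteqP; split=> x /=.
- move=> /leq_bigminnP[_ h] [k /= kK lk].
  by have := h k.+2 _ lk; lia.
- move=> h; apply/leq_bigminnP; split=> // -[|[|k]]// /andP[_ _] lk.
  rewrite leqNgt; apply/negP => kK; apply: h; exists k => //=; lia.
Qed.

Theorem theoremA1 (R : realType)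
    (* underlying probability space, training sample, aggregation sample *)
    (dO dY dX : nat -> measure_display)
    (Omega : forall n, measurableType (dO n))
    (Y : forall n, measurableType (dY n))
    (X : forall n, measurableType (dX n))
    (Pr : forall n, probability (Omega n) R)
    (train : forall n, {mfun Omega n >-> Y n})
    (aggr : forall n, {mfun Omega n >-> X n})
    (Pstar : forall n, probability (X n) R)
    (aggr_law : forall n, has_law (Pr n) (aggr n) (Pstar n))
    (train_aggr_indep : forall n, independent_rv (Pr n) (train n) (aggr n))
    (* models *)
    (M : nat -> nat) (M_gt0 : forall n, (0 < M n)%N)
    (U : nat -> Type) (Theta : forall n, nat -> set (U n))
    (law : forall n, U n -> probability (X n) R)
    (models_nested : forall n, nested (@law n) (Theta n) (M n))
    (* loss *)
    (ell : forall n, probability (X n) R -> X n -> R)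
    (ell_ge0 : forall n P x, 0 <= ell n P x)
    (ell_meas : forall n theta, full_model (Theta n) (M n) theta ->
       measurable_fun [set: X n] (ell n (law n theta)))
    (ell_star_meas : forall n, measurable_fun [set: X n] (ell n (Pstar n)))
    (* candidate estimators, functions of the training sample *)
    (cand : forall n, Y n -> nat -> U n)
    (candP : forall n y k, (1 <= k <= M n)%N -> Theta n k (cand n y k))
    (lambda : R) (lambda_gt0 : 0 < lambda)
    (exp_moments : exists xi1 xi2 xi3 : R,
       [/\ 0 < xi1, 0 < xi2, 0 < xi3 &
        \forall n \near \oo, forall theta, full_model (Theta n) (M n) theta ->
          exp_moment_bounds (law n) (Pstar n) (ell n) lambda xi1 xi2 xi3 theta]) :
  exists tau C8 : R, [/\ 0 < tau, 0 < C8 &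
    \forall n \near \oo, forall y : Y n,
      let risk k := excess_risk (law n) (Pstar n) (ell n) (cand n y k) in
      let mtilde x :=
        stopping_index (M n) (fun k => ell n (law n (cand n y k)) x) in
      let kdag := near_optimal_index (M n) risk tau in
      let eta := kdag%:R * expR (- C8 * risk kdag) in
      ((1 - eta)%:E <= Pstar n [set x | (minn kdag.+1 (M n) <= mtilde x)%N])%E].
Proof.
have [xi1 [xi2 [xi3 [xi1_gt0 xi2_gt0 xi3_gt0 {}exp_moments]]]] := exp_moments.
pose tau := xi3 / (xi1 * xi2); pose C8 := xi1 * xi2 / (1 + xi2).
have tau_gt0 : 0 < tau by rewrite divr_gt0 ?mulr_gt0.
have C8_gt0 : 0 < C8 by rewrite divr_gt0 ?mulr_gt0 ?addr_gt0.
exists tau, C8; split=> //.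
(* The moment bounds hold on the whole model at once, so the threshold on [n] does not depend on the
   training value [y]. *)
apply: filterS exp_moments => n moments y.
pose risk k := excess_risk (law n) (Pstar n) (ell n) (cand n y k).
pose loss k x := ell n (law n (cand n y k)) x.
pose kdag := near_optimal_index (M n) risk tau; pose K := minn kdag.+1 (M n).
change ((1 - kdag%:R * expR (- C8 * risk kdag))%:E <=
  Pstar n [set x | (K <= stopping_index (M n) (fun k => loss k x))%N])%E.
have kdag_gt0 : (0 < kdag)%N by exact: near_optimal_index_gt0.
have [kdagM drop] := near_optimal_indexP (M n) risk tau.
rewrite -/kdag in kdagM drop.
have [risk_le0|risk_gt0] := leP (risk kdag) 0.
  apply: (@le_trans _ _ 0%E) => //; rewrite lee_fin subr_le0.
  rewrite -[leLHS]mulr1 ler_pM ?ler1n// -{1}expR0 ler_expR.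
  by rewrite mulNr oppr_ge0 mulr_ge0_le0// ltW.
have in_model k : (1 <= k <= M n)%N -> full_model (Theta n) (M n) (cand n y k).
  by move=> kM; exists k => //; exact: candP.
have loss_meas k : (1 <= k <= M n)%N -> measurable_fun [set: X n] (loss k).
  by move=> kM; apply: ell_meas; exact: in_model.
pose B k := [set x | loss k.+1 x < loss k.+2 x].
have K_range k : (k < K - 2)%N ->
    [/\ (1 <= k.+1 <= M n)%N, (1 <= k.+2 <= M n)%N & (k.+2 <= kdag)%N].
  by rewrite /K => kK; split; lia.
have mB k : (k < K - 2)%N -> measurable (B k).
  by move=> /K_range[k1M k2M _]; apply: measurable_set_ltr; exact: loss_meas.
have PB k : (k < K - 2)%N -> (Pstar n (B k) <= (expR (- C8 * risk kdag))%:E)%E.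
  move=> /K_range[k1M k2M k2kdag].
  have [lower _] := moments _ (in_model _ k1M).
  have [_ upper] := moments _ (in_model _ k2M).
  (* The loss of [Pstar] cancels in the comparison, while the moment bounds concern excess
     losses. *)
  have -> : B k = [set x |
      excess_loss (law n) (Pstar n) (ell n) (cand n y k.+1) x
      < excess_loss (law n) (Pstar n) (ell n) (cand n y k.+2) x].
    by apply/seteqP; split=> x; rewrite /B /loss /excess_loss /= ltrD2r.
  apply: le_trans (crossing_probability_le _ _ lambda_gt0 _ lower upper) _.
  - by apply: measurable_funB => //; exact: loss_meas.
  - by apply: measurable_funB => //; exact: loss_meas.
  - by rewrite mulr_gt0.
  (* [k2kdag] serves for both index ranges, since their lower bounds compute to true. *)
  have risk_k := risk_ge_near_optimal tau_gt0 (ltW risk_gt0) (k := k.+2) k2kdag.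
  rewrite -/kdag in risk_k; have drop_k := drop k.+1 k2kdag.
  (* [lambda] cancels from the exponent. The drop gives [risk k.+1 - tau * risk k.+2 > risk k.+2],
     which is at least [risk kdag]. *)
  rewrite lee_fin ler_expR
    (_ : _ / _ = - (C8 * (risk k.+1 - tau * risk k.+2))); last first.
    rewrite -/(risk k.+1) -/(risk k.+2) /C8 /tau; field.
    by rewrite !gt_eqF ?addr_gt0 ?mulr_gt0.
  by rewrite mulNr lerN2 ler_pM2l//; lra.
rewrite stopping_index_ge_setE ?geq_minr//.
have mU : measurable (\big[setU/set0]_(k < K - 2) B k).
  by apply: bigsetU_measurable => k _; exact: mB.
rewrite probability_setC// EFinB leeB//.
apply: le_trans (Boole_inequality _ mB) _.
apply: (@le_trans _ _ (\sum_(k < K - 2) (expR (- C8 * risk kdag))%:E)%E).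
  by apply: lee_sum => k _; exact: PB.
(* The union has [K - 2] events, at most [kdag - 1]; the factor [kdag] in the bound is slightly
   generous. *)
rewrite sumEFin lee_fin sumr_const card_ord -[leLHS]mulr_natl.
by rewrite ler_wpM2r ?expR_ge0// ler_nat /K; lia.
Qed.
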